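(* Let $\mathbf F$ be a finite field. Being simple is a generic property of finite-dimensional algebras over $\mathbf F$: if $\varphi(m)$ is the number of pairwise nonisomorphic $m$-dimensional algebras over $\mathbf F$ and $\varphi_{s}(m)$ is the number of those of them that are simple, then $$\lim_{m\to\infty}\frac{\varphi_{s}(m)}{\varphi(m)}=1.$$
   Context: An algebra over a field $\mathbf F$ is a vector space over $\mathbf F$ with an arbitrary bilinear multiplication (not assumed associative, commutative or unital). Algebras are counted up to isomorphism. A nonzero algebra is simple if it has no proper nonzero two-sided ideals. *)

(* Defs.v *)
From HB Require Import structures.
From mathcomp Require Import all_boot all_order all_algebra all_field.
From mathcomp Require Import all_classical all_reals all_analysis.
Set Implicit Arguments.
Unset Strict Implicit.
Unset Printing Implicit Defensive.
Import Order.TTheory GRing.Theory Num.Theory.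
Import VectorInternalTheory.
Local Open Scope ring_scope.

(* A bilinear multiplication on V is a linear map V -> End(V): the product of *)
(* x and y is A x y. No associativity, commutativity or unit is required.     *)
Definition algebra (F : fieldType) (V : vectType F) := 'Hom(V, 'End(V)).

Definition alg_iso (F : fieldType) (V W : vectType F)
    (A : algebra V) (B : algebra W) : Prop :=
  exists f : 'Hom(V, W),
    bijective f /\ forall x y : V, f (A x y) = B (f x) (f y).

Definition ideal (F : fieldType) (V : vectType F) (A : algebra V)
    (I : {vspace V}) : Prop :=
  forall x y : V, x \in I -> A x y \in I /\ A y x \in I.

Definition simple_alg (F : fieldType) (V : vectType F) (A : algebra V) : Prop :=
  (fullv : {vspace V}) <> 0%VS /\
  forall I : {vspace V}, ideal A I -> I = 0%VS \/ I = fullv.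

Lemma alg_iso_refl (F : fieldType) (V : vectType F) (A : algebra V) :
  alg_iso A A.
Proof.
exists \1%VF; split; last by move=> x y; rewrite !id_lfunE.
by exists id => x /=; rewrite id_lfunE.
Qed.

Lemma alg_iso_sym (F : fieldType) (V W : vectType F)
    (A : algebra V) (B : algebra W) : alg_iso A B -> alg_iso B A.
Proof.
move=> [f [[g fK gK] fM]].
have linv x : (f^-1)%VF x = g x.
  have kf : lker f == 0%VS by apply/lker0P; exact: can_inj fK.
  by rewrite -{1}[x]gK lker0_lfunK.
exists (f^-1)%VF; split.
  by exists f => x; rewrite linv.
by move=> x y; rewrite !linv; apply: (can_inj fK); rewrite fM !gK.
Qed.

Lemma alg_iso_trans (F : fieldType) (U V W : vectType F)
    (A : algebra U) (B : algebra V) (C : algebra W) :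
  alg_iso A B -> alg_iso B C -> alg_iso A C.
Proof.
move=> [f [bf fM]] [g [bg gM]]; exists (g \o f)%VF; split.
  by apply: (eq_bij (bij_comp bg bf)) => x /=; rewrite comp_lfunE.
by move=> x y; rewrite !comp_lfunE fM gM.
Qed.

Lemma alg_iso_rV (F : fieldType) (V : vectType F) (m : nat) (A : algebra V) :
  \dim (fullv : {vspace V}) = m -> exists B : algebra 'rV[F]_m, alg_iso A B.
Proof.
rewrite dimvf => <-.
pose g : 'Hom('rV[F]_(dim V), V) := linfun r2v.
pose f : 'Hom(V, 'rV[F]_(dim V)) := linfun v2r.
pose mulB (x : 'rV[F]_(dim V)) : 'End('rV[F]_(dim V)) :=
  (f \o A (g x) \o g)%VF.
have linB : linear mulB.
  move=> a x y; apply/lfunP => z.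
  rewrite add_lfunE scale_lfunE !comp_lfunE (linearP g) (linearP A).
  by rewrite add_lfunE scale_lfunE linearP.
pose mulB_lin := GRing.isLinear.Build F _ _ _ mulB linB.
pose mulBL : {linear 'rV[F]_(dim V) -> 'End('rV[F]_(dim V))} :=
  HB.pack mulB mulB_lin.
exists (linfun mulBL), f; split.
  by exists r2v => x; rewrite lfunE /= ?v2rK ?r2vK.
have gf z : g (f z) = z by rewrite !lfunE /= v2rK.
by move=> x y; rewrite [linfun mulBL _]lfunE /= /mulB !comp_lfunE !gf.
Qed.

(* finvect_type only endows the space of multiplications with a finType.      *)
Definition fin_algebra (F : finFieldType) (m : nat) : finType :=
  finvect_type (algebra 'rV[F]_m).

(* For isomorphism-invariant P: by alg_iso_rV, each class of m-dimensional     *)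
(* F-algebras satisfying P is represented by a multiplication on F^m.         *)
Definition num_classes (F : finFieldType) (m : nat)
    (P : algebra 'rV[F]_m -> Prop) : nat :=
  #|equivalence_partition
      (fun A B : fin_algebra F m =>
         `[< alg_iso (A : algebra 'rV[F]_m) (B : algebra 'rV[F]_m) >])
      [set A : fin_algebra F m | `[< P A >]]|.

Definition num_algs (F : finFieldType) (m : nat) : nat :=
  num_classes (fun _ : algebra 'rV[F]_m => True).

Definition num_simple_algs (F : finFieldType) (m : nat) : nat :=
  num_classes (fun A : algebra 'rV[F]_m => simple_alg A).

(* Main.v *)
(** Counting up to a base change.  Write q = |F|.  Isomorphism classes have at
    most q^(m^2) members, so there are at least q^(m^3 - m^2) of them.  A class
    that is not simple contains a multiplication for which the span of the first
    k basis vectors is an ideal, 0 < k < m, and this forces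
    (m^2 - (m-k)^2)(m-k) structure constants to vanish.  For k <= m-2 that is at
    least m^2 + m - 2, which is enough.  For k = m-1 it is only m^2 - 1; but the
    transvections e_m |-> e_m + v, with v in the ideal, then produce q^(m-1)
    distinct isomorphic copies, unless some nonzero v of the ideal annihilates
    the ideal from the left, which is a rare event.  Hence at most a proportion
    O(m / q^(m-2)) of the classes is not simple. *)

From HB Require Import structures.
Require Import Defs.
From mathcomp Require Import all_boot all_order all_algebra all_field.
From mathcomp Require Import all_classical all_reals all_analysis.
From mathcomp Require Import zify.
Set Implicit Arguments.
Unset Strict Implicit.
Unset Printing Implicit Defensive.
Import GRing.Theory Num.Theory.
Import numFieldNormedType.Exports.
Local Open Scope ring_scope.

(** * Cardinalities and counting by fibres *)

Lemma card_finvect (F : finFieldType) (V : vectType F) :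
  #|finvect_type V| = (#|F| ^ dim V)%N.
Proof.
by rewrite -(card_vspacef (Vector.class (finvect_type V))) card_vspace dimvf.
Qed.

Lemma card_fin_algebra (F : finFieldType) (m : nat) :
  #|fin_algebra F m| = (#|F| ^ (m ^ 3))%N.
Proof.
rewrite card_finvect.
have -> : dim (algebra 'rV[F]_m) = (1 * m * (1 * m * (1 * m)))%N by [].
by rewrite !mul1n.
Qed.

(** The blocks are the traces on [D] of the full classes. Taking the trace is injective on classes
    that meet [D]. Counting full classes makes counts for different [D] comparable as images under
    one map. *)
Lemma card_equivalence_partition (T : finType) (e : rel T) (D : {set T}) :
  reflexive e -> symmetric e -> transitive e ->
  #|equivalence_partition e D| = #|[set [set y | e x y] | x in D]|.
Proof.
move=> e_refl e_sym e_trans.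
have cls_inj x y : e x y -> [set z | e x z] = [set z | e y z].
  move=> exy; apply/setP=> z; rewrite !inE; apply/idP/idP; last exact: e_trans.
  by apply: e_trans; rewrite e_sym.
have -> : equivalence_partition e D =
    (fun C : {set T} => D :&: C) @: [set [set y | e x y] | x in D].
  rewrite -imset_comp; apply: eq_imset => x /=.
  by apply/setP=> y; rewrite !inE.
rewrite card_in_imset // => _ _ /imsetP[x Dx ->] /imsetP[y Dy ->] /setP/(_ y).
by rewrite !inE Dy e_refl => /cls_inj.
Qed.

(** The fibres over distinct points are disjoint subsets of [X]. Only the points of [f @: Y] need a
    large fibre, and the fibre is measured in [X], not in [Y]. *)
Lemma card_imset_fiber (S T : finType) (f : S -> T) (X Y : {set S}) (c : nat) :
  (forall a, a \in Y -> c <= #|[set b in X | f b == f a]|)%N ->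
  (#|f @: Y| * c <= #|X|)%N.
Proof.
move=> fib; rewrite -sum_nat_const.
apply: (@leq_trans (\sum_(t in f @: Y) #|[set b in X | f b == t]|)%N).
  by apply: leq_sum => _ /imsetP[a Ya ->]; exact: fib.
rewrite -[leqRHS]sum1_card.
rewrite (partition_big f (fun t => t \in f @: X));
  last by move=> x Xx; exact: imset_f.
rewrite [leqRHS](bigID (mem (f @: Y))) /= big_andbC -[leqLHS]addn0 leq_add //.
rewrite [leqLHS](bigID (mem (f @: X))) /= [X in (_ + X)%N]big1 ?addn0.
  by apply: leq_sum => t _; rewrite -sum1dep_card.
move=> t /andP[_ Xt]; apply/eqP; rewrite cards_eq0; apply/eqP/setP=> b.
by rewrite !inE; apply: contraNF Xt => /andP[Xb /eqP <-]; exact: imset_f.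
Qed.

(** * Isomorphism classes and a lower bound for their number *)

Definition iso_class (F : finFieldType) (m : nat) (A : fin_algebra F m) :
    {set fin_algebra F m} :=
  [set B : fin_algebra F m |
    `[< alg_iso (A : algebra 'rV[F]_m) (B : algebra 'rV[F]_m) >]].

Lemma iso_class_eq (F : finFieldType) (m : nat) (A B : fin_algebra F m) :
  alg_iso (A : algebra 'rV[F]_m) (B : algebra 'rV[F]_m) ->
  iso_class A = iso_class B.
Proof.
move=> AB; apply/setP=> C; rewrite !inE; apply/asboolP/asboolP.
  exact: alg_iso_trans (alg_iso_sym AB).
exact: alg_iso_trans AB.
Qed.

Lemma num_classesE (F : finFieldType) (m : nat) (P : algebra 'rV[F]_m -> Prop) :
  num_classes P =
    #|[set iso_class A | A in [set A : fin_algebra F m | `[< P A >]]]|.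
Proof.
apply: card_equivalence_partition => [A|A B|A B C].
- exact/asboolP/alg_iso_refl.
- by apply/asboolP/asboolP; exact: alg_iso_sym.
- move=> /asboolP isoBA /asboolP isoAC; apply/asboolP.
  exact: alg_iso_trans isoAC.
Qed.

Lemma alg_iso_inj (F : fieldType) (V : vectType F) (A B C : algebra V)
    (f : 'Hom(V, V)) : bijective f ->
  (forall x y, f (A x y) = B (f x) (f y)) ->
  (forall x y, f (A x y) = C (f x) (f y)) -> B = C.
Proof.
move=> [g _ gK] fB fC; apply/lfunP => x; apply/lfunP => y.
by rewrite -[x]gK -[y]gK -fB -fC.
Qed.

(** Choosing an isomorphism from [A] to each member of its class injects the class into the
    endomorphisms of F^m, since a bijection determines the multiplication it carries [A] to. *)
Lemma card_iso_class (F : finFieldType) (m : nat) (A : fin_algebra F m) :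
  (#|iso_class A| <= #|F| ^ (m ^ 2))%N.
Proof.
have -> : (#|F| ^ (m ^ 2) = #|finvect_type 'End('rV[F]_m)|)%N.
  rewrite card_finvect.
  by have -> : dim 'End('rV[F]_m) = (1 * m * (1 * m))%N by []; rewrite !mul1n.
(* The default 0 is returned only for [B] outside the class of [A]. *)
pose wit (B : fin_algebra F m) : finvect_type 'End('rV[F]_m) :=
  xget 0 [set f : 'End('rV[F]_m) | bijective f /\
    forall x y, f ((A : algebra 'rV[F]_m) x y) =
      (B : algebra 'rV[F]_m) (f x) (f y)]%classic.
have witP B : B \in iso_class A -> bijective (wit B : 'End('rV[F]_m)) /\
    forall x y, (wit B : 'End('rV[F]_m)) ((A : algebra 'rV[F]_m) x y) =
      (B : algebra 'rV[F]_m) ((wit B : 'End('rV[F]_m)) x)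
        ((wit B : 'End('rV[F]_m)) y).
  rewrite inE => /asboolP[f fP].
  by rewrite /wit; case: xgetP => [g _ //|/(_ f)].
rewrite -(@card_in_imset _ _ wit) ?max_card // => B C.
move=> /witP[bB fB] /witP[_ fC] BC.
by rewrite -BC in fC; exact: alg_iso_inj bB fB fC.
Qed.

Lemma num_algs_lower_bound (F : finFieldType) (m : nat) :
  (#|F| ^ (m ^ 3) <= num_algs F m * #|F| ^ (m ^ 2))%N.
Proof.
rewrite -card_fin_algebra /num_algs num_classesE.
have -> : [set A : fin_algebra F m | `[< True >]] = [set: fin_algebra F m]%SET.
  by apply/setP=> A; rewrite !inE; apply/asboolP.
rewrite -cardsT -sum1_card.
rewrite (partition_big (@iso_class F m)
    (mem (@iso_class F m @: [set: fin_algebra F m]%SET))) /=;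
  last by move=> A _; exact: imset_f.
rewrite -sum_nat_const; apply: leq_sum => _ /imsetP[A _ ->].
apply: leq_trans (card_iso_class A); rewrite sum1dep_card.
apply/subset_leq_card/fintype.subsetP => B.
rewrite finset.in_set => /andP[_ /eqP <-]; rewrite finset.in_set.
exact/asboolP/alg_iso_refl.
Qed.

(** * Transport of a multiplication along a base change *)

Section Transport.
Variables (F : fieldType) (m : nat).
Implicit Types (A : algebra 'rV[F]_m) (P : 'M[F]_m).

Definition transport_mul A P (x : 'rV[F]_m) : 'End('rV[F]_m) :=
  (linfun (mulmxr (invmx P)) \o A (x *m P) \o linfun (mulmxr P))%VF.

Lemma transport_mul_linear A P : linear (transport_mul A P).
Proof.
move=> a x y; apply/lfunP => z.
rewrite add_lfunE scale_lfunE !comp_lfunE mulmxDl -scalemxAl (linearP A).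
by rewrite add_lfunE scale_lfunE linearP.
Qed.

HB.instance Definition _ A P :=
  GRing.isLinear.Build F _ _ _ (transport_mul A P) (transport_mul_linear A P).

Definition transport A P : algebra 'rV[F]_m := linfun (transport_mul A P).

Lemma transportE A P x y :
  transport A P x y = A (x *m P) (y *m P) *m invmx P.
Proof.
by rewrite [transport A P _]lfunE /= /transport_mul !comp_lfunE !lfunE.
Qed.

Lemma transport_iso A P : P \in unitmx -> alg_iso (transport A P) A.
Proof.
move=> uP; exists (linfun (mulmxr P)); split.
  by exists (mulmxr (invmx P)) => x; rewrite !lfunE /= (mulmxK, mulmxKV).
by move=> x y; rewrite !lfunE /= comp_lfunE !lfunE /= mulmxKV.
Qed.
End Transport.

(** * Structure constants *)

Definition struct_const (F : fieldType) (m : nat) (A : algebra 'rV[F]_m)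
    (t : 'I_m * 'I_m * 'I_m) : F :=
  A (delta_mx 0 t.1.1) (delta_mx 0 t.1.2) 0 t.2.

Lemma algebra_mulE (F : fieldType) (m : nat) (A : algebra 'rV[F]_m)
    (x y : 'rV[F]_m) (l : 'I_m) :
  A x y 0 l = \sum_i \sum_j x 0 i * y 0 j * struct_const A (i, j, l).
Proof.
rewrite [x in LHS]row_sum_delta linear_sum sum_lfunE summxE.
apply: eq_bigr => i _; rewrite linearZ scale_lfunE mxE.
rewrite [y in LHS]row_sum_delta linear_sum summxE mulr_sumr.
by apply: eq_bigr => j _; rewrite linearZ mxE mulrA.
Qed.

Lemma struct_const_inj (F : fieldType) (m : nat) (A B : algebra 'rV[F]_m) :
  struct_const A =1 struct_const B -> A = B.
Proof.
move=> AB; apply/lfunP => x; apply/lfunP => y; apply/rowP => l.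
rewrite !algebra_mulE; apply: eq_bigr => i _; apply: eq_bigr => j _.
by rewrite AB.
Qed.

(** The constants outside [Z] act as free parameters: if they determine those in [Z], then [S]
    injects into the functions supported off [Z]. Used both when the constants in [Z] vanish and
    when some of them solve linear equations. *)
Lemma card_struct_const (F : finFieldType) (m : nat) (S : {set fin_algebra F m})
    (Z : {set 'I_m * 'I_m * 'I_m}) :
  {in S &, forall A B : algebra 'rV[F]_m,
    (forall t, t \notin Z -> struct_const A t = struct_const B t) ->
    forall t, t \in Z -> struct_const A t = struct_const B t} ->
  (#|S| <= #|F| ^ (m ^ 3 - #|Z|))%N.
Proof.
move=> inj.
(* Erasing the entries in [Z] to 0 yields a function supported on the complement of [Z]. *)
pose r (A : fin_algebra F m) : {ffun 'I_m * 'I_m * 'I_m -> F} :=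
  [ffun t => if t \in Z then 0 else struct_const (A : algebra 'rV[F]_m) t].
have r_inj : {in S &, injective r}.
  move=> A B SA SB /ffunP rAB; apply: struct_const_inj => t.
  have AB u : u \notin Z -> struct_const (A : algebra 'rV[F]_m) u =
      struct_const (B : algebra 'rV[F]_m) u.
    by move=> /negbTE uZ; move: (rAB u); rewrite !ffunE uZ.
  by have [tZ|/AB//] := boolP (t \in Z); exact: inj.
have -> : (m ^ 3 - #|Z| = #|~: Z|)%N.
  by rewrite [in RHS]cardsCs finset.setCK !card_prod card_ord -mulnA.
rewrite -(card_in_imset r_inj) -(card_pffun_on 0 (~: Z) F).
apply: subset_leq_card; apply/fintype.subsetP => _ /imsetP[A _ ->].
apply/pffun_onP; split=> [|//]; apply/supportP => t.
by rewrite inE negbK ffunE => ->.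
Qed.

(** * Ideals spanned by the first basis vectors *)

Definition leading (F : fieldType) (m k : nat) (x : 'rV[F]_m) :=
  [forall l : 'I_m, (k <= l)%N ==> (x 0 l == 0)].

Lemma leadingP (F : fieldType) (m k : nat) (x : 'rV[F]_m) :
  reflect (forall l : 'I_m, (k <= l)%N -> x 0 l = 0) (leading k x).
Proof.
apply: (iffP forallP) => [H l kl|H l]; first exact/eqP/(implyP (H l)).
by apply/implyP => /H ->.
Qed.

(** Index triples of the components, outside the span of the first [k] basis vectors, of products
    with a factor in that span. *)
Definition leading_zeros (m k : nat) : {set 'I_m * 'I_m * 'I_m} :=
  [set t : 'I_m * 'I_m * 'I_m |
    ((t.1.1 < k) || (t.1.2 < k))%N && (k <= t.2)%N].

Definition leading_ideal (F : finFieldType) (m k : nat) :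
    {set fin_algebra F m} :=
  [set A : fin_algebra F m | [forall t in leading_zeros m k,
    struct_const (A : algebra 'rV[F]_m) t == 0]].

Lemma leading_delta (F : fieldType) (m k : nat) (i : 'I_m) :
  (i < k)%N -> leading k (delta_mx 0 i : 'rV[F]_m).
Proof.
move=> ik; apply/leadingP => l kl; rewrite mxE eqxx /=.
by case: eqP => // il; move: kl; rewrite il leqNgt ik.
Qed.

Lemma leading_idealP (F : finFieldType) (m k : nat) (A : fin_algebra F m) :
  reflect (forall x y : 'rV[F]_m, leading k x ->
      leading k ((A : algebra 'rV[F]_m) x y) /\
      leading k ((A : algebra 'rV[F]_m) y x))
    (A \in leading_ideal F m k).
Proof.
rewrite inE; apply: (iffP forall_inP) => [H x y /leadingP xk|H [[i j] l]].
  have H' (i j l : 'I_m) : (i < k)%N || (j < k)%N -> (k <= l)%N ->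
    struct_const (A : algebra 'rV[F]_m) (i, j, l) = 0.
    by move=> ij kl; apply/eqP/H; rewrite inE ij.
  split; apply/leadingP => l kl; rewrite algebra_mulE big1 // => i _;
    rewrite big1 // => j _.
    by case: (ltnP i k) => ik; [rewrite H' ?ik ?mulr0|rewrite xk ?mul0r].
  by case: (ltnP j k) => jk;
    [rewrite H' ?jk ?orbT ?mulr0|rewrite xk ?mulr0 ?mul0r].
rewrite inE /= => /andP[ij kl]; apply/eqP; rewrite /struct_const /=.
case/orP: ij => [ik|jk].
  by have [/leadingP/(_ l kl)] := H _ (delta_mx 0 j) (leading_delta F ik).
by have [_ /leadingP/(_ l kl)] := H _ (delta_mx 0 i) (leading_delta F jk).
Qed.

(** The matrix of the projection onto [I] has row space [I]; this makes the Gaussian elimination of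
    matrices available for subspaces. *)
Lemma vspace_rowspan (F : fieldType) (m : nat) (I : {vspace 'rV[F]_m}) :
  exists M : 'M[F]_m, forall x : 'rV[F]_m, (x \in I) = (x <= M)%MS.
Proof.
exists (lin1_mx (projv I)) => x; apply/idP/submxP => [xI|[y ->]].
  by exists x; rewrite mul_rV_lin1 /= projv_id.
by rewrite mul_rV_lin1 /= memv_proj.
Qed.

Lemma leadingE (F : fieldType) (m k : nat) (x : 'rV[F]_m) :
  leading k x = (x *m pid_mx k == x).
Proof.
have xE l : (x *m pid_mx k) 0 l = if (l < k)%N then x 0 l else 0.
  rewrite mxE (bigD1 l) //= big1 ?addr0 => [|i il]; rewrite mxE.
    by rewrite eqxx; case: ifP => _; rewrite (mulr1, mulr0).
  by rewrite (_ : (i == l :> nat) = false) ?mulr0 //; exact/negbTE.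
apply/leadingP/eqP => [xk|<- l kl]; last by rewrite xE ltnNge kl.
by apply/rowP => l; rewrite xE; case: ltnP => // /xk.
Qed.

(** A base change moves a proper nonzero ideal onto the span of the first [k] basis vectors, with
    [k] its dimension. *)
Lemma nonsimple_leading_ideal (F : finFieldType) (m : nat)
    (A : fin_algebra F m) : (0 < m)%N -> ~ simple_alg (A : algebra 'rV[F]_m) ->
  exists k (B : fin_algebra F m),
    [/\ (0 < k < m)%N, B \in leading_ideal F m k & iso_class B = iso_class A].
Proof.
move=> m0 nsA.
have [I [idI I0 I1]] : exists I : {vspace 'rV[F]_m},
    [/\ ideal (A : algebra 'rV[F]_m) I, I <> 0%VS & I <> fullv].
  apply: contrapT => noI; apply: nsA; split.
    move/eqP; rewrite -dimv_eq0 dimvf.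
    have -> : dim 'rV[F]_m = (1 * m)%N by [].
    by rewrite mul1n -leqn0 leqNgt m0.
  move=> I idI; have [->|I0] := EM (I = 0%VS); first by left.
  by right; apply: contrapT => I1; apply: noI; exists I.
have [M IM] := vspace_rowspan I.
pose P := row_ebase M; have uP : P \in unitmx by exact: row_ebase_unit.
(* [M] factors as [col_ebase M *m pid_mx (\rank M) *m P] with invertible outer factors, so right
   multiplication by [P] maps the span of the first [\rank M] basis vectors onto the row space of
   [M], which is [I]. *)
have leadP (x : 'rV[F]_m) : leading (\rank M) x = (x *m P \in I).
  rewrite IM leadingE; apply/eqP/idP => [<-|/submxP[y xPE]].
    apply/submxP; exists (x *m invmx (col_ebase M)).
    rewrite -{3}[M]mulmx_ebase !mulmxA mulmxKV ?col_ebase_unit //.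
  have -> : x = y *m col_ebase M *m pid_mx (\rank M).
    by rewrite -[x](mulmxK uP) xPE -{1}[M]mulmx_ebase !mulmxA mulmxK.
  by rewrite -mulmxA pid_mx_id // rank_leq_row.
exists (\rank M), (transport (A : algebra 'rV[F]_m) P : fin_algebra F m); split.
- apply/andP; split.
    rewrite lt0n mxrank_eq0; apply/eqP => M0; apply: I0; apply/vspaceP => x.
    by rewrite IM M0 submx0 memv0.
  rewrite ltn_neqAle rank_leq_row andbT; apply/eqP => fM; apply: I1.
  by apply/vspaceP => x; rewrite IM memvf submx_full // /row_full fM.
- apply/leading_idealP => x y; rewrite !leadP !transportE !mulmxKV // => xI.
  exact: idI.
- exact/iso_class_eq/transport_iso.
Qed.

(** * Counting multiplications with a prescribed ideal *)

Lemma card_ord_ge (m k : nat) : #|[set i : 'I_m | (k <= i)%N]| = (m - k)%N.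
Proof.
rewrite -sum1dep_card -(big_mkord (fun i => k <= i)%N (fun=> 1%N)).
have [km|mk] := leqP k m; last first.
  rewrite big_nat_cond big1 => [|i].
    by apply/esym/eqP; rewrite subn_eq0 ltnW.
  by move=> /andP[/andP[_ im] ki]; lia.
rewrite (@big_cat_nat _ _ _ k) //= big_nat_cond big1 ?add0n;
  last by move=> i; lia.
rewrite big_nat_cond (eq_bigl (fun i => (k <= i < m)%N && true));
  last by move=> i; lia.
by rewrite -big_nat_cond sum_nat_const_nat muln1.
Qed.

Lemma card_leading_zeros (m k : nat) :
  #|leading_zeros m k| = ((m ^ 2 - (m - k) ^ 2) * (m - k))%N.
Proof.
pose U := [set i : 'I_m | (k <= i)%N].
have -> : leading_zeros m k = finset.setX (~: finset.setX U U) U.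
  by apply/setP=> -[[i j] l]; rewrite !inE /= negb_and -!ltnNge.
rewrite cardsX [#|~: _|]cardsCs finset.setCK cardsX card_prod card_ord.
by rewrite card_ord_ge !mulnn.
Qed.

Lemma card_leading_ideal (F : finFieldType) (m k : nat) :
  (#|leading_ideal F m k| <=
     #|F| ^ (m ^ 3 - (m ^ 2 - (m - k) ^ 2) * (m - k)))%N.
Proof.
rewrite -card_leading_zeros; apply: card_struct_const => A B.
rewrite !inE => /forall_inP XA /forall_inP XB _ t tZ.
by rewrite (eqP (XA t tZ)) (eqP (XB t tZ)).
Qed.

(** Guarantees that the truncated subtractions in [m ^ 3 - m ^ 2 - m + 2] are exact. *)
Lemma sqrn_add_leq_cube (m : nat) : (1 < m)%N -> (m ^ 2 + m <= m ^ 3)%N.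
Proof. rewrite !expnS expn0 !muln1; nia. Qed.

Lemma card_bigcup_leq (I T : finType) (P : pred I) (S : I -> {set T}) :
  (#|\bigcup_(i | P i) S i| <= \sum_(i | P i) #|S i|)%N.
Proof.
elim/big_rec2: _ => [|i c U _ IH]; first by rewrite cards0.
by apply: leq_trans (leq_card_setU _ _) _; rewrite leq_add2l.
Qed.

(** With j = m - k >= 2, the number of vanishing constants is kj(k + 2j). Here kj >= m - 1, because
    (k - 1)(j - 1) >= 0, and k + 2j = m + j >= m + 2; the product of the two bounds is m^2 + m -
    2. *)
Lemma card_leading_ideal_small (F : finFieldType) (m k : nat) :
  (0 < k)%N -> (k.+1 < m)%N ->
  (#|leading_ideal F m k| <= #|F| ^ (m ^ 3 - m ^ 2 - m + 2))%N.
Proof.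
move=> k0 km; apply: leq_trans (card_leading_ideal F m k) _.
apply: leq_pexp2l; first exact: ltnW (finNzRing_gt1 F).
have [j jm] : exists j, m = (k + j)%N by exists (m - k)%N; lia.
have j1 : (1 < j)%N by lia.
rewrite [in X in (X <= _)%N]jm addKn -jm.
have -> : (m ^ 2 - j ^ 2 = k * (k + 2 * j))%N.
  rewrite jm !expnS expn0 !muln1; nia.
have kj : (m - 1 <= k * j)%N by rewrite jm; nia.
have : ((m - 1) * (m + 2) <= k * j * (k + 2 * j))%N.
  by apply: leq_mul => //; lia.
have -> : (k * j * (k + 2 * j) = k * (k + 2 * j) * j)%N by lia.
have -> : ((m - 1) * (m + 2) = m ^ 2 + m - 2)%N.
  rewrite !expnS expn0 !muln1; nia.
have := @sqrn_add_leq_cube m; lia.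
Qed.

(** * Ideals of codimension one *)

Section Hyperplane.
Variables (F : finFieldType) (n : nat).
Implicit Types (A : fin_algebra F n.+1) (v x y : 'rV[F]_n.+1).

Definition leading_rows : {set 'rV[F]_n.+1} := [set v | leading n v].

Lemma leading_hyperplane v : leading n v = (v 0 ord_max == 0).
Proof.
apply/leadingP/eqP => [/(_ ord_max (leqnn _))//|v0 l nl].
rewrite (_ : l = ord_max) //; apply/val_inj/eqP.
by rewrite eqn_leq nl -ltnS ltn_ord.
Qed.

Lemma card_leading_rows : #|leading_rows| = (#|F| ^ n)%N.
Proof.
pose ext (u : 'rV[F]_n) : 'rV[F]_n.+1 :=
  \row_i oapp (u 0) 0 (unlift ord_max i).
have ext_inj : injective ext.
  move=> u w /rowP uw; apply/rowP => i.
  by move: (uw (lift ord_max i)); rewrite !mxE liftK.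
rewrite -[n in RHS]mul1n -card_mx -(card_imset _ ext_inj); apply: eq_card => v.
rewrite inE leading_hyperplane; apply/eqP/imsetP => [v0|[u _ ->]].
  exists (\row_i v 0 (lift ord_max i)) => //; apply/rowP => i; rewrite !mxE.
  by case: unliftP => [j ->|->] /=; rewrite ?mxE.
by rewrite mxE unlift_none.
Qed.

Definition transvection v : 'M[F]_n.+1 := 1%:M + delta_mx ord_max 0 *m v.

Lemma mul_transvection x v :
  x *m transvection v = x + x 0 ord_max *: v.
Proof.
rewrite mulmxDr mulmx1 mulmxA; congr (_ + _).
apply/rowP => j; rewrite !mxE big_ord1 !mxE (bigD1 ord_max) //= big1 ?addr0.
  by rewrite !mxE !eqxx mulr1.
by move=> i im; rewrite !mxE (negbTE im) mulr0.
Qed.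

Lemma leading_transvection x v : leading n x -> x *m transvection v = x.
Proof.
rewrite leading_hyperplane mul_transvection => /eqP ->.
by rewrite scale0r addr0.
Qed.

(** As [v] has last coordinate 0, the transvection by [- v] is the inverse. *)
Lemma transvection_unit v : leading n v -> transvection v \in unitmx.
Proof.
move=> v0.
suff /mulmx1_unit[] : transvection v *m transvection (- v) = 1%:M by [].
apply/row_matrixP => i; rewrite !rowE mulmx1 mulmxA !mul_transvection.
move: v0; rewrite leading_hyperplane => /eqP v0.
have vE (y : 'rV[F]_n.+1) c : (y + c *: v) 0 ord_max = y 0 ord_max.
  by rewrite !mxE v0 mulr0 addr0.
by rewrite vE scalerN addrK.
Qed.

Lemma leading_mul_invmx x v :
  leading n v -> leading n x -> x *m invmx (transvection v) = x.
Proof.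
move=> v0 /(leading_transvection v) {1}<-.
by rewrite mulmxK ?transvection_unit.
Qed.

Lemma transport_leading_ideal A v : leading n v ->
  A \in leading_ideal F n.+1 n ->
  (transport (A : algebra 'rV[F]_n.+1) (transvection v) : fin_algebra F n.+1)
    \in leading_ideal F n.+1 n.
Proof.
move=> v0 /leading_idealP XA; apply/leading_idealP => x y x0.
have [Axy Ayx] := XA x (y *m transvection v) x0.
by rewrite !transportE leading_transvection // !leading_mul_invmx.
Qed.

(** The transvection fixes the hyperplane pointwise, hence both [y] and the product, which lies in
    the ideal. Only the left factor e_m changes, to e_m + v. So the transported multiplication
    determines the left action of [v] on the hyperplane. *)
Lemma transport_row_max A v y : leading n v -> leading n y ->
  A \in leading_ideal F n.+1 n ->
  transport (A : algebra 'rV[F]_n.+1) (transvection v) (delta_mx 0 ord_max) y =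
  (A : algebra 'rV[F]_n.+1) (delta_mx 0 ord_max) y +
    (A : algebra 'rV[F]_n.+1) v y.
Proof.
move=> v0 y0 /leading_idealP XA.
have [_ Axy] := XA y (delta_mx 0 ord_max *m transvection v) y0.
rewrite transportE (leading_transvection v y0) (leading_mul_invmx v0 Axy).
rewrite mul_transvection mxE !eqxx scale1r.
by rewrite (linearD (A : algebra 'rV[F]_n.+1)) add_lfunE.
Qed.

Definition annihilating v : {set fin_algebra F n.+1} :=
  [set A in leading_ideal F n.+1 n |
    [forall y in leading_rows, (A : algebra 'rV[F]_n.+1) v y == 0]].

Definition faithful_hyperplane : {set fin_algebra F n.+1} :=
  leading_ideal F n.+1 n :\: \bigcup_(v in leading_rows :\ 0) annihilating v.

(** If [v] and [w] give the same transported multiplication, then [v - w] annihilates the hyperplane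
    from the left, so it is zero. The q^n transvections thus give distinct members of the class, all
    keeping the hyperplane as an ideal. *)
Lemma card_iso_class_faithful A : A \in faithful_hyperplane ->
  (#|F| ^ n <=
    #|[set B in leading_ideal F n.+1 n | iso_class B == iso_class A]|)%N.
Proof.
rewrite finset.in_setD => /andP[nA XA]; rewrite -card_leading_rows.
pose B v : fin_algebra F n.+1 :=
  transport (A : algebra 'rV[F]_n.+1) (transvection v).
have B_inj : {in leading_rows &, injective B}.
  move=> v w; rewrite !inE => v0 w0 Bvw; apply/eqP; rewrite -subr_eq0.
  apply: contraNT nA => vw0; apply/bigcupP; exists (v - w).
    rewrite !inE vw0 leading_hyperplane !mxE.
    move: v0 w0; rewrite !leading_hyperplane => /eqP -> /eqP ->.
    by rewrite subr0 eqxx.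
  rewrite inE XA; apply/forall_inP => y; rewrite inE => y0.
  have := transport_row_max v0 y0 XA.
  have -> : transport (A : algebra 'rV[F]_n.+1) (transvection v) = B w by [].
  rewrite /B transport_row_max // => /addrI Avw.
  by rewrite (linearB (A : algebra 'rV[F]_n.+1)) add_lfunE opp_lfunE Avw subrr.
rewrite -(card_in_imset B_inj); apply: subset_leq_card.
apply/fintype.subsetP => _ /imsetP[v v0 ->].
move: v0; rewrite !inE => v0; apply/andP; split.
  by have := transport_leading_ideal v0 XA; rewrite inE.
by apply/eqP/iso_class_eq/transport_iso/transvection_unit.
Qed.

(** Annihilation by [v] adds n^2 linear equations, one for each pair (b, c) of indices below [n].
    Since [v 0 i] is nonzero, each can be solved for the constant at (i, b, c), which is one more
    dependent parameter. *)
Lemma card_annihilating v : v \in leading_rows -> v != 0 ->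
  (#|annihilating v| <=
     #|F| ^ (n.+1 ^ 3 - ((n.+1 ^ 2 - 1) + n ^ 2)))%N.
Proof.
rewrite inE => v0 /rV0Pn[i vi].
have ltin : (i < n)%N.
  rewrite ltnNge; apply: contra vi => ni; apply/eqP.
  exact: (leadingP _ _ v0).
pose U := [set i : 'I_n.+1 | (n <= i)%N].
pose W := finset.setX (finset.setX [set i] (~: U)) (~: U).
pose Z := leading_zeros n.+1 n :|: W.
have cU : #|U| = 1%N by rewrite card_ord_ge subSnn.
have cZ : #|Z| = ((n.+1 ^ 2 - 1) + n ^ 2)%N.
  (* The union is disjoint: the third index is [n] in [leading_zeros] and below [n] in [W]. *)
  rewrite cardsU (_ : _ :&: _ = finset.set0) ?cards0 ?subn0.
    rewrite card_leading_zeros subSnn exp1n muln1; congr (_ + _)%N.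
    rewrite !cardsX cards1 mul1n [#|~: U|]cardsCs finset.setCK cU.
    by rewrite card_ord subn1.
  by apply/setP=> -[[a b] c]; rewrite !inE /= -!ltnNge; lia.
rewrite -cZ; apply: card_struct_const => A B.
rewrite !inE => /andP[/forall_inP XA /forall_inP nA].
move=> /andP[/forall_inP XB /forall_inP nB] AB [[a b] c].
have [tZ|tZ] := boolP ((a, b, c) \in leading_zeros n.+1 n).
  by rewrite (eqP (XA _ tZ)) (eqP (XB _ tZ)).
rewrite /Z finset.in_setU (negbTE tZ) !inE /= -!ltnNge.
move=> /andP[/andP[/eqP -> bn] cn].
have sumE (C : algebra 'rV[F]_n.+1) :
    \sum_a v 0 a * struct_const C (a, b, c) = C v (delta_mx 0 b) 0 c.
  rewrite algebra_mulE; apply: eq_bigr => a' _.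
  rewrite (bigD1 b) //= mxE !eqxx mulr1.
  rewrite big1 ?addr0 // => j jb; rewrite mxE (negbTE jb) andbF mulr0.
  by rewrite mul0r.
have db : delta_mx 0 b \in leading_rows by rewrite inE leading_delta.
have := sumE B; have := sumE A.
rewrite (eqP (nA _ db)) (eqP (nB _ db)) mxE => sA sB.
rewrite (bigD1 i) //= in sA; rewrite (bigD1 i) //= in sB.
(* Off [i], every constant in the equation either vanishes or lies outside [Z], so it agrees for [A]
   and [B]. *)
have rest :
    \sum_(a | a != i) v 0 a * struct_const (A : algebra 'rV[F]_n.+1) (a, b, c) =
    \sum_(a | a != i) v 0 a * struct_const (B : algebra 'rV[F]_n.+1) (a, b, c).
  apply: eq_bigr => a' ai; congr (_ * _).
  have [tZ'|tZ'] := boolP ((a', b, c) \in leading_zeros n.+1 n).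
    by rewrite (eqP (XA _ tZ')) (eqP (XB _ tZ')).
  by apply: AB; rewrite /Z finset.in_setU (negbTE tZ') !inE /= (negbTE ai).
rewrite rest in sA; exact: (mulfI vi (addIr _ (etrans sA (esym sB)))).
Qed.

Lemma card_iso_class_hyperplane : (2 < n)%N ->
  (#|[set iso_class A | A in leading_ideal F n.+1 n]| <=
    2 * #|F| ^ (n.+1 ^ 3 - n.+1 ^ 2 - n.+1 + 2))%N.
Proof.
move=> n2; have F0 : (0 < #|F|)%N := ltnW (finNzRing_gt1 F).
pose bad := \bigcup_(v in leading_rows :\ 0) annihilating v.
have -> : leading_ideal F n.+1 n = faithful_hyperplane :|: bad.
  apply/setP => A; rewrite /faithful_hyperplane -/bad.
  rewrite !(finset.in_setU, finset.in_setD).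
  case: (boolP (A \in bad)) => [|_]; last by rewrite orbF.
  by move=> /bigcupP[v _]; rewrite inE => /andP[-> _]; rewrite orbT.
rewrite imsetU; apply: leq_trans (leq_card_setU _ _) _.
rewrite mul2n -addnn; apply: leq_add.
  (* Faithful part: each class has at least q^n members among at most q^(m^3 - m^2 + 1)
     multiplications, where m = n + 1; dividing gives exactly the required exponent. *)
  rewrite -(leq_pmul2r (_ : 0 < #|F| ^ n)%N) ?expn_gt0 ?F0 //.
  apply: leq_trans (card_imset_fiber card_iso_class_faithful) _.
  apply: leq_trans (card_leading_ideal F n.+1 n) _.
  rewrite -expnD leq_pexp2l // subSnn exp1n muln1.
  have := @sqrn_add_leq_cube n.+1; lia.
apply: leq_trans (leq_imset_card _ _) _.
(* Annihilated part: a union over at most q^n vectors. The final comparison of exponents reduces to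
   2n <= n^2. *)
apply: leq_trans
  (_ : #|F| ^ n * #|F| ^ (n.+1 ^ 3 - ((n.+1 ^ 2 - 1) + n ^ 2)) <= _)%N.
  rewrite -card_leading_rows -sum_nat_const.
  apply: leq_trans (card_bigcup_leq _ _) _.
  rewrite big_mkcond [leqRHS]big_mkcond; apply: leq_sum => v _.
  rewrite !inE; case: eqP => //= v0.
  by case: ifP => // vn; apply: card_annihilating; rewrite ?inE //; exact/eqP.
rewrite -expnD leq_pexp2l //.
rewrite !expnS expn0 !muln1; nia.
Qed.
End Hyperplane.

(** * The proportion of simple classes tends to 1 *)

Lemma num_simple_leq (F : finFieldType) (m : nat) :
  (num_simple_algs F m <= num_algs F m)%N.
Proof.
rewrite /num_simple_algs /num_algs !num_classesE.
apply/subset_leq_card/imsetS/fintype.subsetP => A _.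
by rewrite inE; exact/asboolP.
Qed.

(** The constant 7 comes from the first case [m] = 4, where 25 <= 28; afterwards the left side at
    most doubles at each step. *)
Lemma sqrn_leq_expn2 (m : nat) : (3 < m)%N -> (m.+1 ^ 2 <= 7 * 2 ^ (m - 2))%N.
Proof.
move=> m3; rewrite -(subnK m3); elim: (m - 4)%N => // d IH.
rewrite addSn subSn ?expnS; last by lia.
rewrite mulnCA; apply: leq_trans (leq_mul (leqnn 2) IH).
rewrite !expnS expn0 !muln1; nia.
Qed.

(** A division-free form of the statement that the nonsimple proportion is at most 7 / (m + 1); this
    weakening of the exponential bound is chosen to match the harmonic sequence. *)
Lemma num_nonsimple_bound (F : finFieldType) (m : nat) : (3 < m)%N ->
  ((num_algs F m - num_simple_algs F m) * m.+1 <= 7 * num_algs F m)%N.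
Proof.
case: m => // n n2; set m := n.+1 in n2 *.
have F0 : (0 < #|F|)%N := ltnW (finNzRing_gt1 F).
pose E := (#|F| ^ (m ^ 3 - m ^ 2 - m + 2))%N.
pose C (k : nat) := [set iso_class A | A in leading_ideal F m k].
have NS : (num_algs F m - num_simple_algs F m <= m.+1 * E)%N.
  rewrite leq_subLR /num_algs /num_simple_algs !num_classesE.
  set S := [set A | `[< simple_alg _ >]].
  apply: leq_trans (_ : #|(@iso_class F m @: S) :|:
                          \bigcup_(k < m | (0 < k)%N) C k| <= _)%N.
    apply/subset_leq_card/fintype.subsetP => _ /imsetP[A _ ->].
    rewrite finset.in_setU.
    case: (boolP (A \in S)) => [SA|]; first by rewrite imset_f.
    rewrite inE => /asboolP/nonsimple_leading_ideal[//|k [B []]].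
    move=> /andP[k0 km] XB <-.
    apply/orP; right; apply/bigcupP; exists (Ordinal km) => //.
    exact: imset_f.
  apply: leq_trans (leq_card_setU _ _) _; rewrite leq_add2l.
  apply: leq_trans (card_bigcup_leq _ _) _.
  (* The last index k = n contributes at most 2E, and each of the [n] earlier ones at most E, which
     gives (n + 2)E = (m + 1)E. *)
  rewrite big_mkcond big_ord_recr /= -/m.
  apply: leq_trans (_ : n * E + 2 * E <= _)%N; last by rewrite -mulnDl addn2.
  apply: leq_add; last by case: ifP => // _; exact: card_iso_class_hyperplane.
  rewrite -[X in (X * _)%N]card_ord -sum_nat_const; apply: leq_sum => k _.
  case: ifP => // k0; apply: leq_trans (leq_imset_card _ _) _.
  by apply: card_leading_ideal_small; rewrite // /m ltnS.
have EN : (E * #|F| ^ (m - 2) <= num_algs F m)%N.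
  rewrite -(leq_pmul2r (_ : 0 < #|F| ^ (m ^ 2))%N) ?expn_gt0 ?F0 //.
  apply: leq_trans (num_algs_lower_bound F m).
  rewrite -!expnD leq_pexp2l //.
  have := @sqrn_add_leq_cube m; lia.
have q2 : (2 ^ (m - 2) <= #|F| ^ (m - 2))%N.
  by rewrite leq_exp2r; [exact: finNzRing_gt1|lia].
have p0 : (0 < 2 ^ (m - 2))%N by rewrite expn_gt0.
(* The factor [2 ^ (m - 2)] is bounded by [#|F| ^ (m - 2)] to apply [EN], and reappears on the right
   through [sqrn_leq_expn2], uniformly in the field. *)
rewrite -(leq_pmul2r p0).
apply: leq_trans (_ : m.+1 * E * m.+1 * #|F| ^ (m - 2) <= _)%N.
  by rewrite !leq_mul.
have -> : (m.+1 * E * m.+1 * #|F| ^ (m - 2) =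
           m.+1 ^ 2 * (E * #|F| ^ (m - 2)))%N.
  by rewrite -mulnn; lia.
apply: leq_trans (leq_mul (sqrn_leq_expn2 _) EN) _; first exact: n2.
by rewrite mulnAC.
Qed.

Local Open Scope classical_set_scope.
Local Open Scope ring_scope.

Theorem theorem22 (F : finFieldType) (R : realType) :
  (fun m : nat => (num_simple_algs F m)%:R / (num_algs F m)%:R : R)
    @ \oo --> (1 : R).
Proof.
(* [harmonic m] is 1 / (m + 1), so the lower bound is that of [num_nonsimple_bound], valid from m =
   4 on. *)
apply: (@squeeze_cvgr _ _ _ _ (fun m => 1 - 7 * harmonic m) (fun=> 1)).
- exists 4%N => // m /= m4.
  have N0 : (0 < (num_algs F m)%:R :> R).
    have : (0 < num_algs F m * #|F| ^ (m ^ 2))%N.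
      apply: leq_trans (num_algs_lower_bound F m).
      by rewrite expn_gt0 (ltnW (finNzRing_gt1 F)).
    by rewrite muln_gt0 ltr0n => /andP[].
  apply/andP; split;
    last by rewrite ler_pdivrMr // mul1r ler_nat num_simple_leq.
  rewrite ler_pdivlMr // mulrBl mul1r lerBlDr addrC -lerBlDr.
  rewrite -natrB ?num_simple_leq // mulrAC ler_pdivlMr ?ltr0n //.
  by rewrite -!natrM ler_nat; exact: num_nonsimple_bound.
- have lim : (fun m => 1 - 7 * @harmonic R m) @ \oo --> (1 - 7 * 0 : R).
    by apply: cvgB; [exact: cvg_cst|apply: cvgMl_tmp; exact: cvg_harmonic].
  rewrite mulr0 subr0 in lim; exact: lim.
- exact: cvg_cst.
Qed.
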